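(* Let $\kappa\ge1$ be an integer, let $\mathbb{E}$ be a vector lattice with property $D$ and let $\mathbb{F}$ be a vector lattice with property $C$. Let two tuples of interval operators $\boldsymbol{A}_\forall=\langle \boldsymbol{A}_1',\dots,\boldsymbol{A}_\kappa'\rangle$, $\boldsymbol{A}_\exists=\langle \boldsymbol{A}_1'',\dots,\boldsymbol{A}_\kappa''\rangle$ with $\boldsymbol{A}_i',\boldsymbol{A}_i''\in\mathbb{IL}(\mathbb{E},\mathbb{F})$ and two tuples of intervals $\boldsymbol{b}_\forall=\langle \boldsymbol{b}_1',\dots,\boldsymbol{b}_\kappa'\rangle$, $\boldsymbol{b}_\exists=\langle \boldsymbol{b}_1'',\dots,\boldsymbol{b}_\kappa''\rangle$ with $\boldsymbol{b}_i',\boldsymbol{b}_i''\in\mathbb{IF}$ be given ($i=1,\dots,\kappa$), written in centrally symmetric form $$\boldsymbol{A}_i'=[\check A_i'-\Delta_i',\check A_i'+\Delta_i'],\quad \boldsymbol{A}_i''=[\check A_i''-\Delta_i'',\check A_i''+\Delta_i''],\quad \boldsymbol{b}_i'=[\check b_i'-\delta_i',\check b_i'+\delta_i'],\quad \boldsymbol{b}_i''=[\check b_i''-\delta_i'',\check b_i''+\delta_i''].$$ Then $x\in\Xi_{iq}^{\kappa}(\boldsymbol{A}_\forall,\boldsymbol{A}_\exists,\boldsymbol{b}_\forall,\boldsymbol{b}_\exists)$ if and only if both of the following hold: $$\left|\sum_{i=1}^{\kappa}\left((\check A_i'+\check A_i'')x-(\check b_i'+\check b_i'')\right)\right|+\sum_{i=1}^{\kappa}(\Delta_i'|x|+\delta_i')\le\sum_{i=1}^{\kappa}(\Delta_i''|x|+\delta_i''),$$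 $$\sum_{i=1}^{l}(\Delta_i'|x|+\delta_i')\le\sum_{i=1}^{l}(\Delta_i''|x|+\delta_i''),\qquad l=1,\dots,\kappa-1.$$
   Context: For an ordered vector space $\mathbb{F}$ over $\mathbb{R}$ with positive cone $\mathbb{F}_+$, an interval in $\mathbb{F}$ is a set $[\underline a,\overline a]=\{x\in\mathbb{F}\mid \underline a\le x\le\overline a\}$ with $\underline a\le\overline a$; $\mathbb{IF}$ is the set of all intervals in $\mathbb{F}$. $\mathbb{L}(\mathbb{E},\mathbb{F})$ is the space of linear operators from $\mathbb{E}$ to $\mathbb{F}$ ordered by the cone of positive operators ($A\le B$ iff $Ax\le Bx$ for all $x\ge0$ in $\mathbb{E}$; this is an order when $\mathbb{E}$ is a vector lattice), and $\mathbb{IL}(\mathbb{E},\mathbb{F})$ is the set of intervals in it (interval operators). In the centrally symmetric form of $[\underline b,\overline b]$ one has $\check b=\frac12(\overline b+\underline b)$, $\delta=\frac12(\overline b-\underline b)\ge0$; for $[\underline A,\overline A]$, $\check A=\frac12(\overline A+\underline A)$, $\Delta=\frac12(\overline A-\underline A)\ge0$. In a vector lattice, $|x|=x\vee(-x)$. A multiplicator in an ordered vector space $\mathbb{G}$ is a linear operator $\tau:\mathbb{G}\to\mathbb{G}$ with $0\le\tau\le I$ ($I$ the identity), i.e. $0\le\tau x\le x$ for all $x\ge 0$. Property $C$: an ordered vector space $\mathbb{F}$ has property $C$ if for all $x,y\in\mathbb{F}_+$ with $x\le y$ there is a multiplicator $\tau$ in $\mathbb{F}$ with $\tau y=x$.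 Property $D$: a vector lattice $\mathbb{E}$ has property $D$ if for all $x,y\in\mathbb{E}_+$ with $x\wedge y=0$ there is a multiplicator $\zeta$ in $\mathbb{E}$ with $\zeta x=x$ and $\zeta y=0$. The solution set is $$\Xi_{iq}^{\kappa}(\boldsymbol{A}_\forall,\boldsymbol{A}_\exists,\boldsymbol{b}_\forall,\boldsymbol{b}_\exists)=\Big\{x\in\mathbb{E}\ \Big|\ (\forall A_\kappa'\in\boldsymbol{A}_\kappa')(\forall b_\kappa'\in\boldsymbol{b}_\kappa')(\exists A_\kappa''\in\boldsymbol{A}_\kappa'')(\exists b_\kappa''\in\boldsymbol{b}_\kappa'')\cdots(\forall A_1'\in\boldsymbol{A}_1')(\forall b_1'\in\boldsymbol{b}_1')(\exists A_1''\in\boldsymbol{A}_1'')(\exists b_1''\in\boldsymbol{b}_1'')\ \sum_{s=1}^{\kappa}(A_s'+A_s'')x=\sum_{s=1}^{\kappa}(b_s'+b_s'')\Big\},$$ where the quantifier blocks appear in order of decreasing index $\kappa,\kappa-1,\dots,1$ (block $\kappa$ outermost). *)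

(* Defs.v *)
From HB Require Import structures.
From mathcomp Require Import all_boot all_order all_algebra.
From mathcomp Require Import all_classical all_reals.

Set Implicit Arguments.
Unset Strict Implicit.
Unset Printing Implicit Defensive.

Import Order.TTheory GRing.Theory Num.Theory.
Local Open Scope ring_scope.

HB.mixin Record isOrderedLmodule (R : realType) V
    of Order.POrder ring_display V & GRing.Lmodule R V := {
  ovs_leD2r : forall z x y : V, x <= y -> x + z <= y + z;
  ovs_leZ : forall (a : R) (x y : V), 0 <= a -> x <= y -> a *: x <= a *: y
}.

#[short(type="orderedLmodType")]
HB.structure Definition OrderedLmodule (R : realType) :=
  { V of Order.POrder ring_display V & GRing.Lmodule R V
       & isOrderedLmodule R V }.

(** The library has no common substructure of [Order.Lattice] and the additive
    structures below [Num.RealDomain], so that HB refuses to join [Order.Lattice]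
    with [GRing.Lmodule].  Hence separate lattice operations, with the axioms of
    [Order.POrder_isMeetSemilattice] and [Order.POrder_isJoinSemilattice]. *)
HB.mixin Record isVectLattice (R : realType) V of OrderedLmodule R V := {
  vmeet : V -> V -> V;
  vjoin : V -> V -> V;
  vlexI : forall x y z : V, (x <= vmeet y z) = (x <= y) && (x <= z);
  vleUx : forall x y z : V, (vjoin x y <= z) = (x <= z) && (y <= z)
}.

#[short(type="vectLatticeType")]
HB.structure Definition VectLattice (R : realType) :=
  { V of OrderedLmodule R V & isVectLattice R V }.

Definition labs (R : realType) (E : vectLatticeType R) (x : E) : E :=
  vjoin x (- x).

Lemma vleUl (R : realType) (E : vectLatticeType R) (x y : E) : x <= vjoin x y.
Proof. by have := lexx (vjoin x y); rewrite vleUx => /andP[]. Qed.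

Lemma vleUr (R : realType) (E : vectLatticeType R) (x y : E) : y <= vjoin x y.
Proof. by have := lexx (vjoin x y); rewrite vleUx => /andP[]. Qed.

Section LinearOperators.
Variables (R : realType) (E F : lmodType R).
Implicit Types (f g h : {linear E -> F}) (a b : R).

Definition linop_zero : {linear E -> F} := \0.
Definition linop_opp f : {linear E -> F} := \- f.
Definition linop_add f g : {linear E -> F} := f \+ g.

Definition linop_scale a f : {linear E -> F} := a \*: f.

Fact linopP f g : (forall x, f x = g x) -> f = g.
Proof.
move=> fg; have {fg} : (f : E -> F) = g by apply/funext.
case: f g => f [[fD] [fZ]] [g [[gD] [gZ]]] /= fg.
case: _ / fg gD gZ => gD gZ.
by rewrite (Prop_irrelevance fD gD) (Prop_irrelevance fZ gZ).
Qed.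

Fact linop_addA : associative linop_add.
Proof. by move=> f g h; apply: linopP => x /=; rewrite addrA. Qed.
Fact linop_addC : commutative linop_add.
Proof. by move=> f g; apply: linopP => x /=; rewrite addrC. Qed.
Fact linop_add0 : left_id linop_zero linop_add.
Proof. by move=> f; apply: linopP => x /=; rewrite add0r. Qed.
Fact linop_addN : left_inverse linop_zero linop_opp linop_add.
Proof. by move=> f; apply: linopP => x /=; rewrite addNr. Qed.

HB.instance Definition _ := GRing.isZmodule.Build {linear E -> F}
  linop_addA linop_addC linop_add0 linop_addN.

Fact linop_scaleA a b f :
  linop_scale a (linop_scale b f) = linop_scale (a * b) f.
Proof. by apply: linopP => x /=; rewrite scalerA. Qed.
Fact linop_scale1 : left_id 1 linop_scale.
Proof. by move=> f; apply: linopP => x /=; rewrite scale1r. Qed.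
Fact linop_scaleDr : right_distributive linop_scale +%R.
Proof. by move=> a f g; apply: linopP => x /=; rewrite scalerDr. Qed.
Fact linop_scaleDl f : {morph linop_scale^~ f : a b / a + b}.
Proof. by move=> a b; apply: linopP => x /=; rewrite scalerDl. Qed.

HB.instance Definition _ := GRing.Zmodule_isLmodule.Build R {linear E -> F}
  linop_scaleA linop_scale1 linop_scaleDr linop_scaleDl.

Lemma linop_addE f g x : (f + g) x = f x + g x. Proof. by []. Qed.
Lemma linop_oppE f x : (- f) x = - f x. Proof. by []. Qed.
Lemma linop_scaleE a f x : (a *: f) x = a *: f x. Proof. by []. Qed.

End LinearOperators.

Lemma vect_lattice_diff (R : realType) (E : vectLatticeType R) (x : E) :
  exists y z : E, [/\ 0 <= y, 0 <= z & x = y - z].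
Proof.
exists (vjoin x 0), (vjoin x 0 - x); split.
- exact: vleUr.
- by have := ovs_leD2r (- x) _ _ (@vleUl _ _ x 0); rewrite subrr.
- by rewrite opprB addrC subrK.
Qed.

Section OrderOnOperators.
Variables (R : realType) (E : vectLatticeType R) (F : orderedLmodType R).
Implicit Types f g h : {linear E -> F}.

Definition linop_le f g : bool := `[< forall x : E, 0 <= x -> f x <= g x >].

Fact linop_le_refl : reflexive linop_le.
Proof. by move=> f; apply/asboolP. Qed.

Fact linop_le_anti : antisymmetric linop_le.
Proof.
move=> f g /andP[/asboolP fg /asboolP gf]; apply: linopP => x.
have pos y : 0 <= y -> f y = g y.
  by move=> y0; apply/le_anti; rewrite fg // gf.
by have [y [z [y0 z0 ->]]] := vect_lattice_diff x; rewrite !linearB !pos.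
Qed.

Fact linop_le_trans : transitive linop_le.
Proof.
move=> g f h /asboolP fg /asboolP gh; apply/asboolP => x x0.
exact: le_trans (fg x x0) (gh x x0).
Qed.

HB.instance Definition _ := Order.Le_isPOrder.Build ring_display
  {linear E -> F} linop_le_refl linop_le_anti linop_le_trans.

Lemma linop_leP f g : reflect (forall x, 0 <= x -> f x <= g x) (f <= g).
Proof. exact: asboolP. Qed.

Fact linop_leD2r h f g : f <= g -> f + h <= g + h.
Proof.
by move=> /linop_leP fg; apply/linop_leP => x x0; apply: ovs_leD2r; apply: fg.
Qed.

Fact linop_leZ (a : R) f g : 0 <= a -> f <= g -> a *: f <= a *: g.
Proof.
move=> a0 /linop_leP fg; apply/linop_leP => x x0.
by apply: ovs_leZ => //; apply: fg.
Qed.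

HB.instance Definition _ := isOrderedLmodule.Build R {linear E -> F}
  linop_leD2r linop_leZ.

End OrderOnOperators.

Definition multiplicator (R : realType) (G : orderedLmodType R)
    (tau : {linear G -> G}) : Prop :=
  forall x : G, 0 <= x -> 0 <= tau x <= x.

Definition propertyC (R : realType) (F : orderedLmodType R) : Prop :=
  forall x y : F, 0 <= x -> 0 <= y -> x <= y ->
  exists2 tau : {linear F -> F}, multiplicator tau & tau y = x.

Definition propertyD (R : realType) (E : vectLatticeType R) : Prop :=
  forall x y : E, 0 <= x -> 0 <= y -> vmeet x y = 0 ->
  exists2 zeta : {linear E -> E},
    multiplicator zeta & zeta x = x /\ zeta y = 0.

(** A nonempty order interval is determined by its endpoints, so it is
    represented by them. *)
Record ordInterval (R : realType) (V : orderedLmodType R) := OrdInterval {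
  lower : V;
  upper : V;
  lower_le_upper : lower <= upper
}.

Section IntervalTheory.
Variables (R : realType) (V : orderedLmodType R).
Implicit Types X : ordInterval V.

Definition mem_ordInterval X : pred V := fun x => lower X <= x <= upper X.
Canonical ordInterval_predType := PredType mem_ordInterval.

Definition center X : V := 2^-1 *: (upper X + lower X).
Definition radius X : V := 2^-1 *: (upper X - lower X).

Lemma lower_center_radius X : lower X = center X - radius X.
Proof.
rewrite /center /radius -scalerBr opprB [_ + lower X]addrC addrACA subrr addr0.
by rewrite -mulr2n -scaler_nat scalerA mulVf ?scale1r // pnatr_eq0.
Qed.

Lemma upper_center_radius X : upper X = center X + radius X.
Proof.
rewrite /center /radius -scalerDr addrACA subrr addr0.
by rewrite -mulr2n -scaler_nat scalerA mulVf ?scale1r // pnatr_eq0.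
Qed.

Lemma radius_ge0 X : 0 <= radius X.
Proof.
rewrite -(scaler0 V 2^-1); apply: ovs_leZ; first by rewrite invr_ge0 ler0n.
by have := ovs_leD2r (- lower X) _ _ (lower_le_upper X); rewrite subrr.
Qed.

End IntervalTheory.

(** [iq_blocks XA' XA'' Xb' Xb'' Phi] prefixes [Phi] with the [n] blocks
    [forall A'_s b'_s, exists A''_s b''_s], the block of highest index being
    outermost.  The chosen elements are collected, in order of increasing
    index, in the tuples passed to [Phi].  Ordinals count from 0: [i : 'I_n]
    is the mathematical index i + 1. *)
Fixpoint iq_blocks (R : realType) (L V : orderedLmodType R) (n : nat) :
    ('I_n -> ordInterval L) -> ('I_n -> ordInterval L) ->
    ('I_n -> ordInterval V) -> ('I_n -> ordInterval V) ->
    (n.-tuple L -> n.-tuple L -> n.-tuple V -> n.-tuple V -> Prop) -> Prop :=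
  match n with
  | 0 => fun _ _ _ _ Phi => Phi [tuple] [tuple] [tuple] [tuple]
  | m.+1 => fun XA' XA'' Xb' Xb'' Phi =>
      let lo T (X : 'I_m.+1 -> T) (i : 'I_m) := X (widen_ord (leqnSn m) i) in
      forall A' : L, A' \in XA' ord_max ->
      forall b' : V, b' \in Xb' ord_max ->
      exists2 A'' : L, A'' \in XA'' ord_max &
      exists2 b'' : V, b'' \in Xb'' ord_max &
      iq_blocks (lo _ XA') (lo _ XA'') (lo _ Xb') (lo _ Xb'')
        (fun sA' sA'' sb' sb'' =>
           Phi [tuple of rcons sA' A'] [tuple of rcons sA'' A'']
               [tuple of rcons sb' b'] [tuple of rcons sb'' b''])
  end.

Definition Xi_iq (R : realType) (E : vectLatticeType R)
    (F : orderedLmodType R) (kappa : nat)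
    (Aforall Aexists : 'I_kappa -> ordInterval {linear E -> F})
    (bforall bexists : 'I_kappa -> ordInterval F) : set E :=
  [set x : E | iq_blocks Aforall Aexists bforall bexists
    (fun A' A'' b' b'' =>
       \sum_(s < kappa) (tnth A' s + tnth A'' s) x =
       \sum_(s < kappa) (tnth b' s + tnth b'' s))].

(* Main.v *)
Require Import Defs.
From HB Require Import structures.
From mathcomp Require Import all_boot all_order all_algebra.
From mathcomp Require Import all_classical all_reals.

Local Open Scope ring_scope.

Set Implicit Arguments.
Unset Strict Implicit.

Import Order.TTheory GRing.Theory Num.Theory.

(** Under properties [C] and [D] the set of residuals [A x - b], with [A] and
    [b] ranging over two intervals, is exactly the interval with center
    [center A x - center b] and radius [radius A |x| + radius b].  Hence only
    the residuals matter, and one solves the inner quantifier blocks by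
    induction, with the right-hand side shifted, before the outermost one: for [w], [d], [r'], [r''] with [0 <= d], every [u'] with
    [|u'| <= r'] has a [u''] with [|u''| <= r''] and [|w + u' + u''| <= d]
    if and only if [|w| + r' <= d + r'']. *)

(** * Domination in ordered vector spaces *)

Section OrderedLmoduleTheory.
Variables (R : realType) (V : orderedLmodType R).
Implicit Types u v w x y : V.

Lemma ovs_subr_ge0 x y : (0 <= y - x) = (x <= y).
Proof.
apply/idP/idP => h.
  by have := ovs_leD2r x _ _ h; rewrite add0r subrK.
by have := ovs_leD2r (- x) _ _ h; rewrite subrr.
Qed.

Lemma ovs_addr_ge0 x y : 0 <= x -> 0 <= y -> 0 <= x + y.
Proof.
by move=> x0 y0; apply: le_trans y0 _; have := ovs_leD2r y _ _ x0; rewrite add0r.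
Qed.

Lemma ovs_double_ge0 x : 0 <= x + x -> 0 <= x.
Proof.
move=> h; have i0 : (0 : R) <= 2^-1 by rewrite invr_ge0 ler0n.
have := ovs_leZ _ _ _ i0 h.
by rewrite scaler0 -mulr2n -scaler_nat scalerA mulVf ?scale1r // pnatr_eq0.
Qed.

(* [|u| <= v], in a form that makes sense without lattice operations and in
   particular for linear operators. *)
Definition dominated u v : bool := (0 <= v - u) && (0 <= v + u).

Lemma dominatedN u v : dominated (- u) v = dominated u v.
Proof. by rewrite /dominated opprK andbC. Qed.

Lemma dominatedD u v u' v' :
  dominated u v -> dominated u' v' -> dominated (u + u') (v + v').
Proof.
move=> /andP[a b] /andP[c d]; apply/andP; split.
  by rewrite opprD addrACA; apply: ovs_addr_ge0.
by rewrite addrACA; apply: ovs_addr_ge0.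
Qed.

Lemma dominated_ge0 u v : dominated u v -> 0 <= v.
Proof.
move=> /andP[a b]; apply: ovs_double_ge0.
by have := ovs_addr_ge0 a b; rewrite addrACA addNr addr0.
Qed.

Lemma dominated_refl v : 0 <= v -> dominated v v.
Proof. by move=> v0; rewrite /dominated subrr lexx ovs_addr_ge0. Qed.

Lemma dominated0 u : dominated u 0 <-> u = 0.
Proof.
split=> [/andP[]|->]; last exact: dominated_refl.
rewrite !add0r => a b; apply/le_anti; rewrite b andbT.
by rewrite -ovs_subr_ge0 sub0r.
Qed.

Lemma in_ordInterval (X : ordInterval V) u :
  (u \in X) = dominated (u - center X) (radius X).
Proof.
rewrite -[u \in X]/(lower X <= u <= upper X) andbC.
rewrite -ovs_subr_ge0 -(ovs_subr_ge0 (lower X)).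
rewrite upper_center_radius lower_center_radius /dominated.
rewrite !opprB [radius X + (center X - u)]addrCA [radius X + (u - center X)]addrCA.
by rewrite addrA.
Qed.

(** The two extreme perturbations [u = r] and [u = - r] already force the bound on the right;
    conversely, dominations add up. This eliminates a universal block. *)
Lemma forall_dominated_dominatedD w r d : 0 <= r ->
  (forall u, dominated u r -> dominated (w + u) d) <-> dominated w (d - r).
Proof.
move=> r0; split=> [h|h u].
  have h1 := h r (dominated_refl r0).
  have h2 : dominated (w - r) d by apply: h; rewrite dominatedN dominated_refl.
  apply/andP; split.
    by case/andP: h1 => + _; rewrite opprD addrA addrAC.
  by case/andP: h2 => _; rewrite addrA addrAC.
by move=> /(dominatedD h); rewrite subrK.
Qed.

End OrderedLmoduleTheory.

Section VectLatticeTheory.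
Variables (R : realType) (E : vectLatticeType R).
Implicit Types x v : E.

Lemma labs_le x v : (labs x <= v) = dominated x v.
Proof.
by rewrite /labs vleUx -!(ovs_subr_ge0 _ v) opprK.
Qed.

Lemma dominated_labs x : dominated x (labs x).
Proof. by rewrite -labs_le. Qed.

End VectLatticeTheory.

(** * Domination between linear operators *)

Section DominatedOperators.
Variables (R : realType) (E : vectLatticeType R) (F : orderedLmodType R).
Implicit Types (B D : {linear E -> F}) (w v : E).

Let linop_ge0 D v : 0 <= D -> 0 <= v -> 0 <= D v.
Proof. by move=> /linop_leP; apply. Qed.

(* The sum of [(D - B) (v + w)] and [(D + B) (v - w)] is twice [D v - B w]. *)
Let linop_sub_ge0 B D w v :
  dominated B D -> dominated w v -> 0 <= D v - B w.
Proof.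
move=> /andP[DB1 DB2] /andP[vw1 vw2]; apply: ovs_double_ge0.
have := ovs_addr_ge0 (linop_ge0 DB1 vw2) (linop_ge0 DB2 vw1).
rewrite !linop_addE linop_oppE !linearB !linearD /=.
move: (D v) (D w) (B v) (B w) => a b c d.
rewrite addrACA [a + b + _]addrACA [- c - d + _]addrACA.
by rewrite subrr addNr addr0 add0r addrACA.
Qed.

Lemma dominated_linop B D w v :
  dominated B D -> dominated w v -> dominated (B w) (D v).
Proof.
move=> BD wv; apply/andP; split; first exact: linop_sub_ge0.
have BND : dominated (- B) D by rewrite dominatedN.
by have := linop_sub_ge0 BND wv; rewrite linop_oppE opprK.
Qed.

Lemma dominated_linopP B D :
  dominated B D <-> forall u : E, 0 <= u -> dominated (B u) (D u).
Proof.
split=> [BD u u0|h]; first exact/dominated_linop/dominated_refl.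
by apply/andP; split; apply/linop_leP => u /h /andP[].
Qed.

End DominatedOperators.

(** * Operators between [-I] and [I] supplied by properties [C] and [D] *)

Section PropertiesCD.
Variables (R : realType) (G : vectLatticeType R).

Let id_op : {linear G -> G} := idfun.

(* [0 <= tau <= I] amounts to [|2 tau - I| <= I]. *)
Lemma dominated_multiplicator (tau : {linear G -> G}) :
  multiplicator tau -> dominated (tau + tau - id_op) id_op.
Proof.
move=> mtau; apply/dominated_linopP => u u0.
have /andP[tu0 tuu] := mtau u u0; rewrite -ovs_subr_ge0 in tuu.
rewrite !linop_addE linop_oppE /=; apply/andP; split.
  by rewrite opprB addrCA opprD addrA addrACA; apply: ovs_addr_ge0.
by rewrite addrC subrK; apply: ovs_addr_ge0.
Qed.

(** A signed form of property [C]. The midpoint [p] of [y] and [d] satisfies [0 <= p <= y], so some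
    multiplicator [tau] sends [y] to [p]; then [2 tau - I] sends [y] to [2 p - y = d]. *)
Lemma propertyC_dominated (d y : G) : propertyC G -> dominated d y ->
  exists2 sigma : {linear G -> G}, dominated sigma id_op & sigma y = d.
Proof.
move=> GC dy; have y0 := dominated_ge0 dy; have /andP[dy1 dy2] := dy.
have half (z : G) : 2^-1 *: z + 2^-1 *: z = z.
  by rewrite -scalerDl -mulr2n -[2^-1 *+ 2]mulr_natr mulVf ?scale1r // pnatr_eq0.
pose p := 2^-1 *: (y + d).
have i0 : (0 : R) <= 2^-1 by rewrite invr_ge0 ler0n.
have p0 : 0 <= p by have := ovs_leZ _ _ _ i0 dy2; rewrite scaler0.
have py : p <= y.
  rewrite -ovs_subr_ge0 -[y in y - p]half -scalerDr -scalerBr.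
  rewrite opprD addrA addrK.
  by have := ovs_leZ _ _ _ i0 dy1; rewrite scaler0.
have [tau mtau tauy] := GC _ _ p0 y0 py.
exists (tau + tau - id_op); first exact: dominated_multiplicator.
by rewrite !linop_addE linop_oppE tauy half /= addrC addrA addNr add0r.
Qed.

(** The positive and negative parts [p] and [q] of [x] are disjoint, so property [D] yields a [zeta]
    fixing [p] and killing [q]. The operator [2 zeta - I] then acts as a sign of [x]: it sends
    [p - q] to [p + q]. *)
Lemma propertyD_labs (x : G) : propertyD G ->
  exists2 eps : {linear G -> G}, dominated eps id_op & eps x = labs x.
Proof.
move=> GD; pose p := vjoin x 0; pose q := p - x.
have p0 : 0 <= p by exact: vleUr.
have q0 : 0 <= q by rewrite ovs_subr_ge0; exact: vleUl.
have xE : x = p - q by rewrite /q opprB addrC subrK.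
have pq0 : vmeet p q = 0.
  set m := vmeet p q.
  have /andP[mp mq] : (m <= p) && (m <= q) by rewrite -vlexI.
  apply/le_anti/andP; split; last by rewrite /m vlexI p0 q0.
  (* As [m <= q = p - x] and [m <= p], the element [p - m] is an upper bound of both [x] and [0],
     hence of their join [p]. This gives [m <= 0]. *)
  have : p <= p - m.
    rewrite {1}/p vleUx ovs_subr_ge0 mp andbT.
    by rewrite -ovs_subr_ge0 addrAC ovs_subr_ge0.
  by rewrite -ovs_subr_ge0 addrAC subrr ovs_subr_ge0.
have [zeta mzeta [zp zq]] := GD _ _ p0 q0 pq0.
have deps := dominated_multiplicator mzeta.
exists (zeta + zeta - id_op) => //; apply/le_anti/andP; split.
  have := dominated_linop deps (dominated_labs x).
  by case/andP=> + _; rewrite ovs_subr_ge0.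
have -> : (zeta + zeta - id_op) x = p + q.
  rewrite !linop_addE linop_oppE /= xE linearB zp zq subr0.
  by rewrite opprB addrACA subrr addr0 addrC.
rewrite labs_le xE; apply/andP; split.
  by rewrite opprB addrC addrA subrK ovs_addr_ge0.
by rewrite addrACA subrr addr0 ovs_addr_ge0.
Qed.

End PropertiesCD.

(** * Residuals over a pair of intervals *)

Lemma residual_image (R : realType) (E F : vectLatticeType R)
    (X : ordInterval {linear E -> F}) (Y : ordInterval F) (x : E) (r : F) :
  propertyD E -> propertyC F ->
  (exists2 A : {linear E -> F}, A \in X & exists2 b, b \in Y & A x - b = r) <->
  dominated (r - (center X x - center Y)) (radius X (labs x) + radius Y).
Proof.
move=> ED FC; split=> [[A + [b + <-]]|].
  rewrite !in_ordInterval => XA Yb.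
  have -> : A x - b - (center X x - center Y)
          = (A - center X) x + - (b - center Y).
    rewrite linop_addE linop_oppE [- (b - _)]opprB [- (center X x - _)]opprB.
    by rewrite addrACA [RHS]addrACA [- b - _]addrC.
  apply: dominatedD; last by rewrite dominatedN.
  exact: dominated_linop XA (dominated_labs x).
move=> /(propertyC_dominated FC)[sigma dsigma sigmaE].
have [eps deps epsE] := propertyD_labs x ED.
(* [eps] turns [x] into [|x|], and [sigma] carries the total radius to the required deviation from
   the center. Splitting [sigma] over the two summands of that radius gives the deviations of [A]
   and of [b]; both stay within their radii because [sigma] and [eps] are dominated by the
   identity. *)
pose B : {linear E -> F} := sigma \o radius X \o eps.
exists (center X + B).
  rewrite in_ordInterval addrC addKr.
  apply/dominated_linopP => u u0.
  have du := dominated_linop deps (dominated_refl u0).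
  have dX := dominated_linop (dominated_refl (radius_ge0 X)) du.
  exact: dominated_linop dsigma dX.
exists (center Y - sigma (radius Y)).
  rewrite in_ordInterval addrC addKr dominatedN.
  exact: dominated_linop dsigma (dominated_refl (radius_ge0 Y)).
have BE : B x = sigma (radius X (labs x)) by rewrite /B /= epsE.
rewrite linop_addE BE opprB addrA -[_ + _ + sigma _]addrA -linearD sigmaE.
by rewrite addrAC addrC subrK.
Qed.

(* Riesz decomposition, with the summands given by a dominated operator. *)
Lemma dominatedD_split (R : realType) (G : vectLatticeType R) (z a b : G) :
  propertyC G -> 0 <= a -> 0 <= b -> dominated z (b + a) ->
  exists2 u, dominated u a & dominated (z + u) b.
Proof.
move=> GC a0 b0 /(propertyC_dominated GC)[sigma dsigma <-].
exists (- sigma a).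
  by rewrite dominatedN; exact: dominated_linop dsigma (dominated_refl a0).
by rewrite linearD addrK; exact: dominated_linop dsigma (dominated_refl b0).
Qed.

(** * Elimination of the quantifier blocks *)

Section QuantifierBlocks.
Variables (R : realType) (E F : vectLatticeType R).
Hypotheses (E_D : propertyD E) (F_C : propertyC F).
Implicit Types (X : ordInterval {linear E -> F}) (Y : ordInterval F).

(** Here [d] is the slack left by the blocks further inside: the existential pair enlarges it by its
    radius, the universal pair diminishes it by its own. *)
Lemma quantifier_block X' X'' Y' Y'' (x : E) (w d : F) : 0 <= d ->
  (forall A', A' \in X' -> forall b', b' \in Y' ->
   exists2 A'', A'' \in X'' & exists2 b'', b'' \in Y'' &
   dominated (w + ((A' + A'') x - (b' + b''))) d) <->
  dominated
    (w + ((center X' + center X'') x - (center Y' + center Y'')))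
    (d + (radius X'' (labs x) + radius Y'')
       - (radius X' (labs x) + radius Y')).
Proof.
move=> d0.
have residualD (A B : {linear E -> F}) (b c : F) :
    (A + B) x - (b + c) = (A x - b) + (B x - c).
  by rewrite linop_addE opprD addrACA.
have cancel (z r c : F) : z + r - (r - c) = z + c.
  by rewrite opprB addrA addrAC addrK.
have rad0 X Y : 0 <= radius X (labs x) + radius Y.
  have l0 := dominated_ge0 (dominated_labs x).
  apply: ovs_addr_ge0 (radius_ge0 Y).
  exact: dominated_ge0 (dominated_linop (dominated_refl (radius_ge0 X))
                                        (dominated_refl l0)).
(* The existential pair, for fixed [A'] and [b']. Replacing its residual by the central one costs at
   most the radius; conversely the Riesz splitting yields a deviation [u], which [residual_image]
   realizes. *)
have inner A' b' :
    (exists2 A'', A'' \in X'' & exists2 b'', b'' \in Y'' &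
      dominated (w + ((A' + A'') x - (b' + b''))) d) <->
    dominated (w + (A' x - b') + (center X'' x - center Y''))
      (d + (radius X'' (labs x) + radius Y'')).
  split=> [[A'' AX [b'' bY]]|].
    rewrite residualD addrA => dom.
    have /(residual_image X'' Y'' x _ E_D F_C) : exists2 A, A \in X'' &
      exists2 b, b \in Y'' & A x - b = A'' x - b'' by exists A'' => //; exists b''.
    rewrite -dominatedN => /(dominatedD dom).
    by rewrite cancel.
  move=> /(dominatedD_split F_C (rad0 _ _) d0)[u du dz].
  have : dominated ((u + (center X'' x - center Y''))
                    - (center X'' x - center Y''))
      (radius X'' (labs x) + radius Y'') by rewrite addrK.
  move=> /(residual_image X'' Y'' x _ E_D F_C)[A'' AX [b'' bY bE]].
  exists A'' => //; exists b'' => //.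
  by rewrite residualD bE [u + _]addrC !addrA in dz *.
rewrite residualD [(center X' x - _) + _]addrC addrA.
split=> [h|/(forall_dominated_dominatedD _ _ (rad0 X' Y')) h A' AX b' bY].
  apply/(forall_dominated_dominatedD _ _ (rad0 X' Y')) => u du.
  have : dominated ((u + (center X' x - center Y'))
                    - (center X' x - center Y'))
      (radius X' (labs x) + radius Y') by rewrite addrK.
  move=> /(residual_image X' Y' x _ E_D F_C)[A' AX [b' bY bE]].
  have /inner := h A' AX b' bY.
  have swap (a b : F) : w + (u + b) + a = w + a + b + u.
    by rewrite [u + b]addrC addrA [LHS]addrAC [w + b + a]addrAC.
  by rewrite bE swap.
apply/inner.
have /(residual_image X' Y' x _ E_D F_C)/h : exists2 A, A \in X' &
  exists2 b, b \in Y' & A x - b = A' x - b' by exists A' => //; exists b'.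
have shift (a c r : F) : w + a + c + (r - c) = w + r + a.
  by rewrite -addrA [c + _]addrC subrK addrAC.
by rewrite shift.
Qed.

Lemma lower_mem (V : orderedLmodType R) (Z : ordInterval V) : lower Z \in Z.
Proof.
by rewrite -[_ \in Z]/(lower Z <= lower Z <= upper Z) lexx lower_le_upper.
Qed.

Lemma sum_widen_cond (V : zmodType) n l (f : 'I_n.+1 -> V) : (l <= n)%N ->
  \sum_(i < n.+1 | (i < l)%N) f i =
  \sum_(i < n | (i < l)%N) f (widen_ord (leqnSn n) i).
Proof.
move=> ln; rewrite big_mkcond big_ord_recr /= ltnNge ln addr0.
by rewrite [RHS]big_mkcond.
Qed.

Lemma tnth_rcons_widen (T : Type) n (s : n.-tuple T) (a : T) (i : 'I_n) :
  tnth [tuple of rcons s a] (widen_ord (leqnSn n) i) = tnth s i.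
Proof. by rewrite !(tnth_nth a) /= nth_rcons size_tuple ltn_ord. Qed.

Lemma tnth_rcons_max (T : Type) n (s : n.-tuple T) (a : T) :
  tnth [tuple of rcons s a] ord_max = a.
Proof. by rewrite (tnth_nth a) /= nth_rcons size_tuple ltnn eqxx. Qed.

(** The shift [w] makes the induction possible: it absorbs the residuals already fixed by outer
    blocks. The partial-sum condition for [l = n] needs no separate listing, since a dominating
    element is nonnegative. *)
Lemma iq_blocks_sumE n (XA' XA'' : 'I_n -> ordInterval {linear E -> F})
    (Xb' Xb'' : 'I_n -> ordInterval F) (x : E) (w : F) :
  let rad' i := radius (XA' i) (labs x) + radius (Xb' i) in
  let rad'' i := radius (XA'' i) (labs x) + radius (Xb'' i) in
  iq_blocks XA' XA'' Xb' Xb'' (fun A' A'' b' b'' =>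
    w + \sum_(i < n) ((tnth A' i + tnth A'' i) x - (tnth b' i + tnth b'' i))
    = 0) <->
  dominated
    (w + \sum_(i < n) ((center (XA' i) + center (XA'' i)) x
                       - (center (Xb' i) + center (Xb'' i))))
    (\sum_(i < n) rad'' i - \sum_(i < n) rad' i) /\
  (forall l : nat, (l < n)%N ->
     \sum_(i < n | (i < l)%N) rad' i <= \sum_(i < n | (i < l)%N) rad'' i).
Proof.
elim: n XA' XA'' Xb' Xb'' w => [|n IHn] XA' XA'' Xb' Xb'' w rad' rad''.
  rewrite /= !big_ord0 subr0 addr0.
  by split=> [->|[/dominated0]] //; split=> //; apply/dominated0.
pose lo T (X : 'I_n.+1 -> T) (i : 'I_n) := X (widen_ord (leqnSn n) i).
(* The induction hypothesis, with the residual of the outermost block moved into [w]. *)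
have step A' A'' b' b'' :
    iq_blocks (lo _ XA') (lo _ XA'') (lo _ Xb') (lo _ Xb'')
      (fun sA' sA'' sb' sb'' =>
        w + \sum_(i < n.+1)
          ((tnth [tuple of rcons sA' A'] i + tnth [tuple of rcons sA'' A''] i) x
          - (tnth [tuple of rcons sb' b'] i + tnth [tuple of rcons sb'' b''] i))
        = 0) <->
    dominated
      (w + \sum_(i < n) ((center (lo _ XA' i) + center (lo _ XA'' i)) x
                       - (center (lo _ Xb' i) + center (lo _ Xb'' i)))
         + ((A' + A'') x - (b' + b'')))
      (\sum_(i < n) lo _ rad'' i - \sum_(i < n) lo _ rad' i) /\
    (forall l : nat, (l < n)%N ->
      \sum_(i < n | (i < l)%N) lo _ rad' i
      <= \sum_(i < n | (i < l)%N) lo _ rad'' i).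
  rewrite addrAC -IHn.
  set Phi := fun _ _ _ _ => w + _ = 0; set Psi := fun _ _ _ _ => _ + _ = 0.
  suff -> : Phi = Psi by [].
  apply/funext => sA'; apply/funext => sA''; apply/funext => sb'.
  apply/funext => sb''; rewrite /Phi /Psi big_ord_recr /= !tnth_rcons_max.
  under eq_bigr do rewrite !tnth_rcons_widen.
  by rewrite addrA [in RHS]addrAC.
have rec_center : w + \sum_(i < n.+1) ((center (XA' i) + center (XA'' i)) x
                       - (center (Xb' i) + center (Xb'' i))) =
    w + \sum_(i < n) ((center (lo _ XA' i) + center (lo _ XA'' i)) x
                       - (center (lo _ Xb' i) + center (lo _ Xb'' i)))
      + ((center (XA' ord_max) + center (XA'' ord_max)) x
                       - (center (Xb' ord_max) + center (Xb'' ord_max))).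
  by rewrite big_ord_recr addrA.
have rec_rad : \sum_(i < n.+1) rad'' i - \sum_(i < n.+1) rad' i =
    (\sum_(i < n) lo _ rad'' i - \sum_(i < n) lo _ rad' i)
      + rad'' ord_max - rad' ord_max.
  by rewrite !big_ord_recr /= opprD addrACA addrA.
have full (f : 'I_n.+1 -> F) :
    \sum_(i < n.+1 | (i < n)%N) f i = \sum_(i < n) lo _ f i.
  by rewrite sum_widen_cond //; apply: eq_bigl => i; rewrite ltn_ord.
rewrite rec_center rec_rad; split=> [h|[dom le_rad]].
  (* Intervals are nonempty, so the universal block can be instantiated at lower endpoints. The
     resulting inequality is both the premise of [quantifier_block] and the new condition
     [l = n]. *)
  have d0 : 0 <= \sum_(i < n) lo _ rad'' i - \sum_(i < n) lo _ rad' i.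
    have [A'' _ [b'' _ /step[/dominated_ge0]]] //:=
      h _ (lower_mem (XA' ord_max)) _ (lower_mem (Xb' ord_max)).
  split.
    apply/(quantifier_block _ _ _ _ _ _ d0) => A' AX b' bY.
    have [A'' AX'' [b'' bY'' /step[dom _]]] := h A' AX b' bY.
    by exists A'' => //; exists b''.
  move=> l; rewrite ltnS leq_eqVlt => /orP[/eqP ->|ln].
    by rewrite !full -ovs_subr_ge0.
  have [A'' _ [b'' _ /step[_ le_rad]]] :=
    h _ (lower_mem (XA' ord_max)) _ (lower_mem (Xb' ord_max)).
  by rewrite !sum_widen_cond ?(ltnW ln) //; exact: le_rad.
(* In this direction the slack is nonnegative by the assumed condition [l = n]. *)
have d0 : 0 <= \sum_(i < n) lo _ rad'' i - \sum_(i < n) lo _ rad' i.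
  by have := le_rad n (ltnSn n); rewrite !full ovs_subr_ge0.
move=> A' AX b' bY.
have /(quantifier_block _ _ _ _ _ _ d0) h := dom.
have [A'' AX'' [b'' bY'' domA]] := h A' AX b' bY.
exists A'' => //; exists b'' => //; apply/step; split=> // l ln.
by have := le_rad l (ltnW ln); rewrite !sum_widen_cond ?(ltnW ln).
Qed.

End QuantifierBlocks.

Theorem mainTheorem3 (R : realType) (E F : vectLatticeType R) (kappa : nat)
    (kappa_ge1 : (1 <= kappa)%N)
    (E_D : propertyD E) (F_C : propertyC F)
    (Aforall Aexists : 'I_kappa -> ordInterval {linear E -> F})
    (bforall bexists : 'I_kappa -> ordInterval F) (x : E) :
  Xi_iq Aforall Aexists bforall bexists x <->
  (labs (\sum_(i < kappa)
           ((center (Aforall i) + center (Aexists i)) x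
            - (center (bforall i) + center (bexists i))))
     + \sum_(i < kappa) (radius (Aforall i) (labs x) + radius (bforall i))
   <= \sum_(i < kappa) (radius (Aexists i) (labs x) + radius (bexists i)))
  /\
  (forall l : nat, (1 <= l <= kappa.-1)%N ->
     \sum_(i < kappa | (i < l)%N)
       (radius (Aforall i) (labs x) + radius (bforall i))
     <= \sum_(i < kappa | (i < l)%N)
          (radius (Aexists i) (labs x) + radius (bexists i))).
Proof.
have blocksE := iq_blocks_sumE E_D F_C Aforall Aexists bforall bexists x 0.
(* Moving the universal radii to the right turns the first inequality into a domination. *)
rewrite -ovs_subr_ge0 [labs _ + _]addrC opprD addrA ovs_subr_ge0 labs_le.
rewrite add0r in blocksE.
apply: (iff_trans _ (iff_trans blocksE _)).
  rewrite /Xi_iq /=.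
  set Phi := fun _ _ _ _ => _ = _; set Psi := fun _ _ _ _ => 0 + _ = 0.
  suff -> : Phi = Psi by [].
  apply/funext => sA'; apply/funext => sA''; apply/funext => sb'.
  apply/funext => sb''; rewrite /Phi /Psi add0r sumrB.
  by apply/propext; split=> [->|/eqP]; rewrite ?subrr // subr_eq0 => /eqP.
(* The ranges [l < kappa] and [1 <= l <= kappa.-1] differ only by [l = 0], where both sums are
   empty. *)
split=> -[dom le_rad]; split=> // l.
  move=> /andP[l1 lk]; apply: le_rad.
  by rewrite -(prednK kappa_ge1) ltnS.
case: l => [_|l lk]; first by rewrite !big_pred0.
apply: le_rad; apply/andP; split=> //.
by rewrite -ltnS (prednK kappa_ge1).
Qed.
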